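(* Let $\Xi_{\mathrm{rob}}$ be the output of Algorithm A (described in the context) run with the dataset $\{\hat\xi_1,\dots,\hat\xi_N\}$, the partition $\{\mathcal{W}_1,\dots,\mathcal{W}_{n_W}\}$, the Wasserstein radius $\theta$ and the tolerance $\epsilon$. Then $$\inf_{\mathbb{Q}\in\mathcal{M}_N^\theta}\mathbb{Q}(\xi\in\Xi_{\mathrm{rob}})\ \ge\ 1-\epsilon .$$
   Context: Uncertainty and partition. The uncertainty is a vector $\xi\in\mathbb{R}^{n_\xi}$ whose components are indexed by a finite set $\mathcal{W}=\{w_1,\dots,w_{n_\xi}\}$. The set $\mathcal{W}$ is partitioned into pairwise disjoint nonempty subsets $\mathcal{W}_1,\dots,\mathcal{W}_{n_W}$ with union $\mathcal{W}$. For $\xi\in\mathbb{R}^{n_\xi}$, $\xi^i\in\mathbb{R}^{|\mathcal{W}_i|}$ denotes the subvector of components indexed by $\mathcal{W}_i$; we identify $\xi$ with $(\xi^1,\dots,\xi^{n_W})$. We write $[K]=\{1,\dots,K\}$. Support. The support set is compact, $\Xi\subset\mathbb{R}_{\ge 0}^{n_\xi}$, and has the form $\Xi=\prod_{i\in[n_W]}\Xi^i$ with $\Xi^i=\{\xi^i\in\mathbb{R}^{|\mathcal{W}_i|} \mid \Gamma^i\xi^i\le\rho^i\}$ for given $\Gamma^i\in\mathbb{R}^{u_i\times|\mathcal{W}_i|}$, $\rho^i\in\mathbb{R}^{u_i}$. Ambiguity set. Given samples $\hat\xi_1,\dots,\hat\xi_N\in\Xi$, let $\hat{\mathbb{Q}}_N=\frac1N\sum_{m=1}^N\delta_{\hat\xi_m}$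 be the empirical distribution. Given $\theta\ge 0$, let $\mathcal{M}_N^\theta=\{\mathbb{Q}\in\mathcal{P}(\Xi) \mid d_w(\mathbb{Q},\hat{\mathbb{Q}}_N)\le\theta\}$, where $\mathcal{P}(\Xi)$ is the set of probability distributions supported on $\Xi$ and $d_w(\mathbb{Q},\hat{\mathbb{Q}}_N)=\min_{\gamma}\int_{\Xi\times\Xi}\|\xi-\hat\xi\|\,\gamma(d\xi,d\hat\xi)$, the minimum being over distributions $\gamma$ on $\Xi\times\Xi$ with marginals $\mathbb{Q}$ and $\hat{\mathbb{Q}}_N$; $\|\cdot\|$ is a fixed norm on Euclidean space. The tolerance is $\epsilon\in(0,1)$. Algorithm A (construction of $\Xi_{\mathrm{rob}}$). (1) For each $i\in[n_W]$: compute the empirical covariance matrix $\widehat{\mathrm{Cov}}^i\in\mathbb{R}^{|\mathcal{W}_i|\times|\mathcal{W}_i|}$ of the subvectors $(\hat\xi_1)^i,\dots,(\hat\xi_N)^i$, and its eigenvalues $\lambda_{(i,1)}\le\dots\le\lambda_{(i,|\mathcal{W}_i|)}$ with corresponding eigenvectors $v_{(i,1)},\dots,v_{(i,|\mathcal{W}_i|)}$; select an integer $\kappa_i\in\{0,\dots,|\mathcal{W}_i|-1\}$; set $n^{\mathrm{DR}}_i=\kappa_i+|\mathcal{W}_i|$. Let $n^{\mathrm{DR}}=\sum_{i=1}^{n_W}n_i^{\mathrm{DR}}$. (2) For $i\in[n_W]$ and $j\in[n_i^{\mathrm{DR}}]$ let $\zeta_{i,j}\in\mathbb{R}^{|\mathcal{W}_i|}$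 be the $j$-th standard unit vector if $j\le|\mathcal{W}_i|$, and $\zeta_{i,j}=v_{(i,j-|\mathcal{W}_i|)}$ otherwise. Let $(\underline b_{i,j},\overline b_{i,j})$ be an optimal solution of $$\min_{(\underline b,\overline b)}\ \overline b-\underline b\quad\text{s.t.}\quad \underline b\le\overline b,\quad \inf_{\mathbb{Q}\in\mathcal{M}_N^\theta}\mathbb{Q}\bigl(\max\{\zeta_{i,j}^\top\xi^i-\overline b,\ \underline b-\zeta_{i,j}^\top\xi^i\}\le 0\bigr)\ge 1-\frac{\epsilon}{n^{\mathrm{DR}}}.$$ (3) Set $\Xi_{\mathrm{rob}}^{i,j}=\{\xi^i\in\mathbb{R}^{|\mathcal{W}_i|} \mid \underline b_{i,j}\le\zeta_{i,j}^\top\xi^i\le\overline b_{i,j}\}$, $\Xi_{\mathrm{rob}}^i=\bigcap_{j=1}^{n_i^{\mathrm{DR}}}\Xi_{\mathrm{rob}}^{i,j}$, and output $\Xi_{\mathrm{rob}}=\prod_{i=1}^{n_W}\Xi_{\mathrm{rob}}^i$. *)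

(* Defs.v *)
From HB Require Import structures.
From mathcomp Require Import all_boot all_order all_algebra.
From mathcomp Require Import all_classical all_reals all_analysis.

Set Implicit Arguments.
Unset Strict Implicit.
Unset Printing Implicit Defensive.

Import Order.TTheory GRing.Theory Num.Theory.
Import numFieldNormedType.Exports.

Local Open Scope classical_set_scope.
Local Open Scope ring_scope.

(* R^n with its Borel sigma-algebra. The carrier is convertible to 'cV[R]_n,
   so a [set 'cV[R]_n] can be measured directly. *)
Definition borel_vec (R : realType) (n : nat) : measurableType _ :=
  g_sigma_algebraType (@open 'cV[R]_n).

Record is_norm (R : realType) (n : nat) (nrm : 'cV[R]_n -> R) : Prop := {
  is_norm_triangle : forall x y, nrm (x + y) <= nrm x + nrm y;
  is_norm_scale : forall (a : R) x, nrm (a *: x) = `|a| * nrm x;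
  is_norm_definite : forall x, nrm x = 0 -> x = 0
}.

Section Partition.
Context {R : realType} {n nW : nat}.

Definition is_partition (W : 'I_nW -> {set 'I_n}) : Prop :=
  [/\ forall i, W i != finset.set0,
      forall i j, i != j -> (W i :&: W j)%SET = finset.set0
    & forall k, exists i, k \in W i].

(* The components of x indexed by A, listed in increasing order of index. *)
Definition subvec (A : {set 'I_n}) (x : 'cV[R]_n) : 'cV[R]_#|A| :=
  \col_(k < #|A|) x (enum_val k) 0.

(* The product of the S i, under the identification of x with the family of its
   subvectors. *)
Definition block_prod (W : 'I_nW -> {set 'I_n})
    (S : forall i, set 'cV[R]_#|W i|) : set 'cV[R]_n :=
  [set x | forall i, S i (subvec (W i) x)].

Definition polyhedron {u d : nat} (G : 'M[R]_(u, d)) (rho : 'cV[R]_u) :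
    set 'cV[R]_d :=
  [set y | forall k, (G *m y) k 0 <= rho k 0].

Definition support_set (W : 'I_nW -> {set 'I_n}) (u : 'I_nW -> nat)
    (Gam : forall i, 'M[R]_(u i, #|W i|)) (rho : forall i, 'cV[R]_(u i)) :
    set 'cV[R]_n :=
  block_prod (fun i => polyhedron (Gam i) (rho i)).

End Partition.

Section Empirical.
Context {R : realType} {n N : nat} (xhat : 'I_N -> 'cV[R]_n).
Local Open Scope ereal_scope.

Definition empirical (A : set (borel_vec R n)) : \bar R :=
  (N%:R^-1)%:E * \sum_(m < N) \d_(xhat m : borel_vec R n) A.

Let dirac_ext (k : nat) : {measure set (borel_vec R n) -> \bar R} :=
  if insub k is Some m then [the measure _ _ of \d_(xhat m : borel_vec R n)]
  else [the measure _ _ of mzero].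

Let inv_ge0 : (0 <= N%:R^-1 :> R)%R.
Proof. by rewrite invr_ge0 ler0n. Qed.

Let empiricalE : empirical = mscale (NngNum inv_ge0) (msum dirac_ext N).
Proof.
apply/funext => A; rewrite /empirical /mscale /msum/=; congr (_ * _).
by apply: eq_bigr => m _; rewrite /dirac_ext valK.
Qed.

Let empirical0 : empirical set0 = 0.
Proof. by rewrite empiricalE measure0. Qed.

Let empirical_ge0 A : 0 <= empirical A.
Proof. by rewrite empiricalE measure_ge0. Qed.

Let empirical_sigma_additive : semi_sigma_additive empirical.
Proof. by rewrite empiricalE; exact: measure_semi_sigma_additive. Qed.

HB.instance Definition _ := isMeasure.Build _ _ _ empirical
  empirical0 empirical_ge0 empirical_sigma_additive.

End Empirical.

Section Wasserstein.
Context {R : realType} {n : nat}.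
Notation T := (borel_vec R n).
Local Open Scope ereal_scope.

Definition is_coupling (Xi : set 'cV[R]_n) (P Q : {measure set T -> \bar R})
    (g : probability (T * T)%type R) : Prop :=
  [/\ g (Xi `*` Xi) = 1,
      forall A : set T, measurable A -> g (fst @^-1` A) = P A
    & forall A : set T, measurable A -> g (snd @^-1` A) = Q A].

(* Couplings live on Xi * Xi. The minimum over couplings is written as an
   infimum, so that no attainment has to be assumed. *)
Definition wasserstein (nrm : 'cV[R]_n -> R) (Xi : set 'cV[R]_n)
    (P Q : {measure set T -> \bar R}) : \bar R :=
  ereal_inf [set \int[g]_(z in Xi `*` Xi) (nrm (z.1 - z.2)%R)%:E
            | g in is_coupling Xi P Q].

Definition ambiguity_set {N : nat} (nrm : 'cV[R]_n -> R) (Xi : set 'cV[R]_n)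
    (xhat : 'I_N -> 'cV[R]_n) (theta : R) : set (probability T R) :=
  [set Q : probability T R |
    Q Xi = 1 /\ wasserstein nrm Xi Q (empirical xhat) <= theta%:E].

Definition worst_case (M : set (probability T R)) (A : set 'cV[R]_n) : \bar R :=
  ereal_inf [set Q A | Q in M].

End Wasserstein.

Section Covariance.
Context {R : realType} {d N : nat} (y : 'I_N -> 'cV[R]_d).

Definition empirical_mean : 'cV[R]_d := N%:R^-1 *: \sum_(m < N) y m.

(* The covariance of the uniform distribution on the samples. Dividing by N - 1
   instead would not change the eigenvectors or the order of the eigenvalues. *)
Definition empirical_cov : 'M[R]_d :=
  N%:R^-1 *: \sum_(m < N) (y m - empirical_mean) *m (y m - empirical_mean)^T.

End Covariance.

(* lam lists the eigenvalues of A with multiplicity. The eigenvectors are not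
   required to be normalized, orthogonal or even linearly independent. *)
Definition is_eigensystem {R : realType} {d : nat} (A : 'M[R]_d)
    (lam : 'I_d -> R) (v : 'I_d -> 'cV[R]_d) : Prop :=
  [/\ char_poly A = \prod_(k < d) ('X - (lam k)%:P),
      forall k l : 'I_d, (k <= l)%N -> lam k <= lam l
    & forall k, v k != 0 /\ A *m v k = lam k *: v k].

Section Algorithm.
Context {R : realType} {n : nat}.

Definition dotv {d : nat} (z y : 'cV[R]_d) : R := (z^T *m y) 0 0.

Definition interval_feasible (M : set (probability (borel_vec R n) R)) (p : R)
    (A : {set 'I_n}) (z : 'cV[R]_#|A|) (blo bhi : R) : Prop :=
  blo <= bhi /\
  (p%:E <= worst_case M [set x : 'cV[R]_n |
     (Num.max (dotv z (subvec A x) - bhi) (blo - dotv z (subvec A x)) <= 0)%R])%E.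

Definition interval_optimal (M : set (probability (borel_vec R n) R)) (p : R)
    (A : {set 'I_n}) (z : 'cV[R]_#|A|) (blo bhi : R) : Prop :=
  interval_feasible M p z blo bhi /\
  forall blo' bhi', interval_feasible M p z blo' bhi' ->
    bhi - blo <= bhi' - blo'.

(* The first d directions are the unit vectors, the next kappa ones are the
   eigenvectors of the kappa smallest eigenvalues. Taking kappa in 'I_d encodes
   0 <= kappa <= d - 1. *)
Definition direction {d : nat} (v : 'I_d -> 'cV[R]_d) (kappa : 'I_d)
    (j : 'I_(d + kappa)) : 'cV[R]_d :=
  match fintype.split j with
  | inl a => delta_mx a 0
  | inr k => v (widen_ord (ltnW (ltn_ord kappa)) k)
  end.

(* [algorithm_output ... Xi_rob]: some run of the algorithm, i.e. some choice of
   eigenvectors, of the integers kappa and of optimal solutions, yields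
   Xi_rob. *)
Definition algorithm_output {nW N : nat} (nrm : 'cV[R]_n -> R)
    (Xi : set 'cV[R]_n) (xhat : 'I_N -> 'cV[R]_n)
    (W : 'I_nW -> {set 'I_n}) (theta eps : R) (Xi_rob : set 'cV[R]_n) : Prop :=
  exists (lam : forall i, 'I_#|W i| -> R)
         (v : forall i, 'I_#|W i| -> 'cV[R]_#|W i|)
         (kappa : forall i, 'I_#|W i|)
         (blo bhi : forall i, 'I_(#|W i| + kappa i) -> R),
    let nDR := (\sum_(i < nW) (#|W i| + kappa i))%N in
    let zeta i := @direction _ (v i) (kappa i) in
    [/\ forall i, is_eigensystem
          (empirical_cov (fun m => subvec (W i) (xhat m))) (lam i) (v i),
        forall i j, interval_optimal (ambiguity_set nrm Xi xhat theta)
          (1 - eps / nDR%:R) (zeta i j) (blo i j) (bhi i j)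
      & Xi_rob = block_prod (fun i =>
          \bigcap_j [set y : 'cV[R]_#|W i| |
                      blo i j <= dotv (zeta i j) y <= bhi i j])].

End Algorithm.

(* Main.v *)
Require Import Defs.
From mathcomp Require Import all_boot all_order all_algebra.
From mathcomp Require Import all_classical all_reals all_analysis.
From mathcomp Require Import lra.

Set Implicit Arguments.
Unset Strict Implicit.
Unset Printing Implicit Defensive.

Import Order.TTheory GRing.Theory Num.Theory.
Import numFieldNormedType.Exports.

Local Open Scope classical_set_scope.
Local Open Scope ring_scope.

(** The bound is a union bound. Membership in the output set means that each of
    the nDR directions satisfies its interval constraint, so the output set is a
    finite intersection of slabs. Feasibility of the interval chosen for one
    direction says that its slab misses at most a mass eps / nDR under every
    distribution of the ambiguity set ([interval_feasible_slab]), so the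
    intersection misses at most nDR * (eps / nDR) = eps ([prob_bigcap_ge]). The
    bound holds for each distribution of the ambiguity set, hence for the
    infimum.

    The union bound needs measurable events: slabs are closed, being preimages
    of closed intervals under continuous linear forms ([measurable_slab]). *)

(** The union bound, in the form that can be nested: the deficits of the events
    add up to a deficit of their intersection. *)
Lemma prob_bigcap_ge d (T : measurableType d) (R : realType)
    (P : probability T R) (I : finType) (A : I -> set T) (delta : I -> R)
    (mA : forall i, measurable (A i))
    (PA : forall i, ((1 - delta i)%:E <= P (A i))%E) :
  ((1 - \sum_i delta i)%:E <= P (\bigcap_i A i))%E.
Proof.
have -> : \bigcap_i A i = \big[setI/setT]_i A i.
  by rewrite -bigcap_seq; apply: eq_bigcapl; split=> i //= _;
    rewrite mem_index_enum.
elim: (index_enum I) => [|i s IHs].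
  by rewrite !big_nil subr0 probability_setT.
rewrite !big_cons; set B := \big[setI/setT]_(_ <- s) _ in IHs *.
have mB : measurable B by exact: bigsetI_measurable.
have : (P (~` (A i `&` B)) <= (1 - P (A i)) + (1 - P B))%E.
  by rewrite -!probability_setC// setCI; apply: measureU2; exact: measurableC.
rewrite probability_setC; last exact: measurableI.
move: (PA i) IHs.
rewrite -(fineK (fin_num_measure P _ (mA i))) -(fineK (fin_num_measure P _ mB)).
rewrite -(fineK (fin_num_measure P _ (measurableI _ _ (mA i) mB))).
by rewrite -!EFinB -EFinD !lee_fin; lra.
Qed.

Lemma continuous_dotv_subvec (R : realType) (n : nat) (A : {set 'I_n})
    (z : 'cV[R]_#|A|) : continuous (fun x : 'cV[R]_n => dotv z (subvec A x)).
Proof.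
have -> : (fun x : 'cV[R]_n => dotv z (subvec A x)) =
    (fun x => \sum_k z k 0 * x (enum_val k) 0).
  by apply/funext => x; rewrite /dotv mxE; apply: eq_bigr => k _; rewrite !mxE.
apply: continuous_big => [|k _ x]; first exact: add_continuous.
by apply: continuousM; [exact: cst_continuous|exact: coord_continuous].
Qed.

(** The confidence region of one direction, as an event on the full uncertainty
    vector rather than as a subset of the space of its block. *)
Definition slab (R : realType) (n : nat) (A : {set 'I_n}) (z : 'cV[R]_#|A|)
    (blo bhi : R) : set (borel_vec R n) :=
  [set x : 'cV[R]_n | blo <= dotv z (subvec A x) <= bhi].

Lemma measurable_slab (R : realType) (n : nat) (A : {set 'I_n})
    (z : 'cV[R]_#|A|) (blo bhi : R) : measurable (slab z blo bhi).
Proof.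
have cl : closed (slab z blo bhi : set 'cV[R]_n).
  have -> : slab z blo bhi =
      (fun x : 'cV[R]_n => dotv z (subvec A x)) @^-1` `[blo, bhi].
    by apply/seteqP; split=> x; rewrite /slab /= in_itv.
  by move/continuous_closedP: (@continuous_dotv_subvec R n A z); apply;
    exact: itv_closed.
(* The Borel sigma-algebra is generated by open sets: pass to the complement. *)
rewrite -[slab _ _ _]setCK; apply: measurableC.
by apply: sub_sigma_algebra; exact: closed_openC.
Qed.

(** The event max (z.x - bhi, blo - z.x) <= 0 of the interval problem is the
    slab blo <= z.x <= bhi. *)
Lemma interval_feasible_slab (R : realType) (n : nat)
    (M : set (probability (borel_vec R n) R)) (p : R) (A : {set 'I_n})
    (z : 'cV[R]_#|A|) (blo bhi : R) (Q : probability (borel_vec R n) R) :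
  interval_feasible M p z blo bhi -> M Q -> (p%:E <= Q (slab z blo bhi))%E.
Proof.
move=> [_ hp] MQ; apply: (le_trans hp); apply: ereal_inf_lbound.
exists Q => //; congr (Q _); apply/seteqP.
by split=> x /=; rewrite /slab /= ge_max !subr_le0 andbC.
Qed.

Theorem mainTheorem1 (R : realType) (n nW N : nat)
    (W : 'I_nW -> {set 'I_n}) (hW : is_partition W)
    (u : 'I_nW -> nat)
    (Gam : forall i : 'I_nW, 'M[R]_(u i, #|W i|))
    (rho : forall i : 'I_nW, 'cV[R]_(u i))
    (Xi : set 'cV[R]_n) (hXi : Xi = support_set Gam rho)
    (Xi_compact : compact Xi)
    (Xi_ge0 : forall x : 'cV[R]_n, Xi x -> forall k : 'I_n, 0 <= x k 0)
    (nrm : 'cV[R]_n -> R) (nrm_norm : is_norm nrm)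
    (N_gt0 : (0 < N)%N)
    (xhat : 'I_N -> 'cV[R]_n) (xhat_Xi : forall m : 'I_N, Xi (xhat m))
    (theta : R) (theta_ge0 : 0 <= theta)
    (eps : R) (eps_gt0 : 0 < eps) (eps_lt1 : eps < 1)
    (Xi_rob : set 'cV[R]_n)
    (hrob : algorithm_output nrm Xi xhat W theta eps Xi_rob) :
  ((1 - eps)%:E <= worst_case (ambiguity_set nrm Xi xhat theta) Xi_rob)%E.
Proof.
case: hrob => lam [v [kappa [blo [bhi /= [_ opt Xi_robE]]]]].
set nDR := (\sum_(i < nW) _)%N in opt.
apply/ereal_infP => _ [Q MQ <-].
pose S i j := slab (direction (v i) (j : 'I_(#|W i| + kappa i)))
  (blo i j) (bhi i j).
have -> : Xi_rob = \bigcap_i \bigcap_j S i j.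
  rewrite Xi_robE; apply/seteqP; split=> x /= hx.
    by move=> i _ j _; exact: hx.
  by move=> i j _; exact: hx.
have mS i j : measurable (S i j) by exact: measurable_slab.
have QS i j : ((1 - eps / nDR%:R)%:E <= Q (S i j))%E.
  by have [feas _] := opt i j; exact: interval_feasible_slab feas MQ.
(* The number of directions depends on the block, so the union bound is applied
   within each block and then across the blocks. *)
have Qblock i : ((1 - \sum_(j < #|W i| + kappa i) eps / nDR%:R)%:E
    <= Q (\bigcap_j S i j))%E by exact: prob_bigcap_ge.
have mblock i : measurable (\bigcap_j S i j).
  by apply: fin_bigcap_measurable => // ; exact: finite_finset.
apply: le_trans (prob_bigcap_ge mblock Qblock).
rewrite lee_fin lerB//.
under eq_bigr do rewrite sumr_const card_ord.
rewrite sumrMnr -/nDR.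
(* When nDR = 0 there are no blocks and the total deficit is an empty sum. *)
have [->|nDR_neq0] := eqVneq nDR 0%N; first by rewrite mulr0n ltW.
by rewrite -(mulr_natr (eps / _)) divfK// pnatr_eq0.
Qed.
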